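(* Let $s\ge 2$, let $a_1,\dots,a_s$ be nonzero integers and let $n$ be an integer. Let the integers $d_i$, $\bar a_i$, $\bar d_i$, $n_1$ be defined from $a_1,\dots,a_s,n$ as in the context, and use the conventions on sums and products given there. If $\gcd(a_1,\dots,a_s)\mid n$, then the set of all integral solutions $(x_1,\dots,x_s)\in\mathbb{Z}^s$ of $$a_1x_1+a_2x_2+\cdots+a_sx_s=n$$ is exactly the set of tuples $(x_1,\dots,x_s)$ of the form $$x_1=n_1\prod_{i=1}^{s-1}\bar d_i^{\,\phi(|\bar a_{i+1}|)-1}+\sum_{m=1}^{s-1}\bar a_{m+1}\Big(\prod_{i=1}^{m-1}\bar d_i^{\,\phi(|\bar a_{i+1}|)-1}\Big)t_m,$$ and, for $k=2,3,\dots,s$, $$x_k=\frac{n_1}{\bar a_k}\Big(1-\bar d_{k-1}^{\,\phi(|\bar a_k|)}\Big)\prod_{i=k}^{s-1}\bar d_i^{\,\phi(|\bar a_{i+1}|)-1}-\bar d_{k-1}t_{k-1}+\sum_{m=2}^{s-1}\frac{\bar a_{m+1}}{\bar a_k}\Big(1-\bar d_{k-1}^{\,\phi(|\bar a_k|)}\Big)\Big(\prod_{i=k}^{m-1}\bar d_i^{\,\phi(|\bar a_{i+1}|)-1}\Big)t_m,$$ where $t_1,t_2,\dots,t_{s-1}$ range over arbitrary integers. (That is, every such tuple is an integral solution, and every integral solution is of this form for some integers $t_1,\dots,t_{s-1}$.)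
   Context: $\phi$ denotes Euler's totient function (with $\phi(1)=1$), and $\gcd$ is the positive greatest common divisor. Notation. Let $d=\gcd(a_1,\dots,a_s)$ and write $n=d\,n_1$. Put $d_2=\gcd(a_1,a_2)$ and $d_i=\gcd(d_{i-1},a_i)$ for $3\le i\le s$, so that $d_s=d$. Define $\bar a_1,\dots,\bar a_s$ by $a_1=d_2\bar a_1$ and $a_i=d_i\bar a_i$ for $2\le i\le s$. Define $\bar d_i$ for $2\le i\le s-1$ by $d_i=d_{i+1}\bar d_i$, and set $\bar d_1=\bar a_1$. Conventions. A sum $\sum_{i=j}^{k}(\cdot)$ with $k<j$ equals $0$. A product $\prod_{i=j}^{j-\lambda}(\cdot)$ equals $1$ if $\lambda=1$ and equals $0$ if $\lambda\ge 2$ (this non-standard second convention means that in the formula for $x_k$ the terms with $m<k$ in the sum over $m$ vanish). *)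

(* Defs.v *)
From mathcomp Require Import all_boot all_order all_algebra.
Set Implicit Arguments.
Unset Strict Implicit.
Unset Printing Implicit Defensive.
Import Order.TTheory GRing.Theory Num.Theory.
Local Open Scope ring_scope.

(* 1-based access to the coordinates v_1, ..., v_s of a finite sequence. *)
Definition nth1 (R : zmodType) (v : seq R) (i : nat) : R := v`_i.-1.

(* For a product from i = j to k with k < j: the value is 1 when k = j - 1,
   but 0 (not 1) when k <= j - 2. *)
Definition bprod (j k : nat) (F : nat -> int) : int :=
  if (k.+1 < j)%N then 0 else \prod_(j <= i < k.+1) F i.

Definition gcd_all (a : seq int) : int := \big[gcdz/0]_(z <- a) z.

(* Only the values for 2 <= i are used: dgcd a 1 = a_1 is the base case giving
   dgcd a 2 = gcd(a_1, a_2). *)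
Fixpoint dgcd (a : seq int) (i : nat) : int :=
  match i with
  | 0 => 0
  | 1 => nth1 a 1
  | j.+1 => gcdz (dgcd a j) (nth1 a i)
  end.

(* For nonzero a_i, the quotients in abar and dbar are exact (see abarE1, abarE
   and dbarE below). *)
Definition abar (a : seq int) (i : nat) : int :=
  if (i <= 1)%N then (nth1 a 1 %/ dgcd a 2)%Z else (nth1 a i %/ dgcd a i)%Z.

Definition dbar (a : seq int) (i : nat) : int :=
  if (i <= 1)%N then abar a 1 else (dgcd a i %/ dgcd a i.+1)%Z.

Lemma abarE1 a : nth1 a 1 = dgcd a 2 * abar a 1.
Proof. by rewrite mulrC /abar divzK //= dvdz_gcdl. Qed.

Lemma abarE a i : (2 <= i)%N -> nth1 a i = dgcd a i * abar a i.
Proof. by case: i => [|[|i]] // _; rewrite mulrC /abar divzK //= dvdz_gcdr. Qed.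

Lemma dbarE a i : (2 <= i)%N -> dgcd a i = dgcd a i.+1 * dbar a i.
Proof. by case: i => [|[|i]] // _; rewrite mulrC /dbar divzK //= dvdz_gcdl. Qed.

(* Main.v *)
Require Import Defs.
From mathcomp Require Import all_boot all_order all_algebra.
From mathcomp Require Import cyclic zify ring.
Set Implicit Arguments.
Unset Strict Implicit.
Unset Printing Implicit Defensive.
Import Order.TTheory GRing.Theory Num.Theory.
Local Open Scope ring_scope.

(* Put y_1 = x_1 and y_{k+1} = dbar_k y_k + abar_{k+1} x_{k+1}; then
   a_1 x_1 + ... + a_k x_k = d_k y_k, so the equation says y_s = n_1.  By Euler's
   theorem 1 - dbar_k ^ phi(|abar_{k+1}|) = abar_{k+1} q_{k+1} with q_{k+1} an
   integer, so with p_k = dbar_k ^ (phi(|abar_{k+1}|) - 1) the integer matrix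
   [[dbar_k, abar_{k+1}], [q_{k+1}, - p_k]] has determinant -1.  It therefore gives
   a bijection (y_k, x_{k+1}) <-> (y_{k+1}, t_k) of Z^2, whose inverse is
     y_k = p_k y_{k+1} + abar_{k+1} t_k,   x_{k+1} = q_{k+1} y_{k+1} - dbar_k t_k.
   Unrolling the recursion for y_k downwards from y_s = n_1 yields the formulas. *)

(** At [k.+1 = j] the product on the left is empty, equal to 1, while the one on the right is
    already 0 by convention; the indicator makes up the difference. *)
Lemma bprod_recl (j k : nat) (F : nat -> int) :
  bprod j k F = F j * bprod j.+1 k F + (k.+1 == j)%:R.
Proof.
rewrite /bprod ltnS; case: (ltngtP k.+1 j) => [lt_kj|lt_jk|<-].
- by rewrite mulr0 addr0.
- by rewrite big_ltn // addr0.
- by rewrite mulr0 add0r big_geq.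
Qed.

Lemma bprod_eq0 (j k : nat) (F : nat -> int) : (k.+1 < j)%N -> bprod j k F = 0.
Proof. by rewrite /bprod => ->. Qed.

(** Replacing [d] by its residue modulo [m], which is nonnegative and still coprime to [m], reduces
    the claim to Euler's theorem on naturals, whatever the signs. *)
Lemma dvdz_euler (d m : int) :
  m != 0 -> coprimez d m -> (m %| 1 - d ^+ totient `|m|)%Z.
Proof.
move=> m0 co_dm; rewrite -eqz_mod_dvd -modzXm.
have d_ge0 : 0 <= (d %% m)%Z by apply: modz_ge0.
have co_rm : coprime `|(d %% m)%Z| `|m|.
  by rewrite -coprimezE /coprimez gcdz_modl.
rewrite -(gez0_abs d_ge0); move: `|(d %% m)%Z|%N co_rm => r co_rm.
rewrite -!(modz_abs _ m) -(rmorphXn Posz) !modz_nat eqz_nat eq_sym natrXE.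
exact/eqP/Euler_exp_totient.
Qed.

(* The closed form of y_k in the header's notation. *)
Definition tail_param (s : nat) (p al : nat -> int) (N : int) (t : seq int)
    (k : nat) : int :=
  N * bprod k (s - 1) p
  + \sum_(1 <= m < s) al m.+1 * bprod k (m - 1) p * nth1 t m.

Lemma tail_param_last s p al N t : (1 <= s)%N -> tail_param s p al N t s = N.
Proof.
move=> s_gt0; rewrite /tail_param big_nat big1 => [|m /andP[m_gt0 lt_ms]].
  by rewrite addr0 /bprod subn1 prednK // ltnn big_geq // mulr1.
by rewrite bprod_eq0 ?mulr0 ?mul0r // subn1 prednK.
Qed.

Lemma tail_param_rec s p al N t k : (1 <= k < s)%N ->
  tail_param s p al N t k
  = p k * tail_param s p al N t k.+1 + al k.+1 * nth1 t k.
Proof.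
move=> /andP[k_gt0 lt_ks]; rewrite /tail_param bprod_recl subn1 prednK; last first.
  exact: leq_ltn_trans lt_ks.
rewrite [s == k]gtn_eqF // addr0 mulrDr mulrCA -addrA; congr (_ + _).
under eq_big_nat => m /andP[m_gt0 _].
  rewrite bprod_recl subn1 prednK // mulrDr mulrDl.
  rewrite (mulrCA _ (p k)) -(mulrA (p k)); over.
rewrite big_split /= mulr_sumr; congr (_ + _).
  by apply: eq_big_nat => m _; rewrite subn1.
(* The indicators from [bprod_recl] survive only at [m = k], which leaves the single new term in
   t_k. *)
rewrite (bigD1_seq k) ?mem_index_iota ?k_gt0 ?iota_uniq //=.
rewrite eqxx mulr1 big1 ?addr0 // => m /negPf ->.
by rewrite mulr0 mul0r.
Qed.

(** These are the y_k of the header; the value at 0 is a filler. *)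
Fixpoint partial_quot (de al X : nat -> int) (k : nat) : int :=
  if k is j.+1 then
    if j is 0 then X 1%N else de j * partial_quot de al X j + al k * X k
  else 0.

Lemma partial_quotS de al X k : (1 <= k)%N ->
  partial_quot de al X k.+1
  = de k * partial_quot de al X k + al k.+1 * X k.+1.
Proof. by case: k. Qed.

Lemma partial_quot_sum (de al X d c : nat -> int) (k : nat) :
    (1 <= k)%N -> c 1%N = d 1%N ->
    (forall i, (1 <= i)%N -> d i = d i.+1 * de i) ->
    (forall i, (2 <= i)%N -> c i = d i * al i) ->
  \sum_(1 <= i < k.+1) c i * X i = d k * partial_quot de al X k.
Proof.
move=> + c1 dE cE; elim: k => // -[|k] IHk _; first by rewrite big_nat1 c1.
by rewrite big_nat_recr //= IHk // cE // (dE k.+1) //=; ring.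
Qed.

Lemma partial_quot_param (s : nat) (de al p q X : nat -> int) (N : int) :
    (1 <= s)%N ->
    (forall k, (1 <= k < s)%N -> al k.+1 * q k.+1 = 1 - de k * p k) ->
  partial_quot de al X s = N <->
  exists t : s.-1.-tuple int, X 1%N = tail_param s p al N t 1 /\
    forall k, (1 <= k < s)%N ->
      X k.+1 = q k.+1 * tail_param s p al N t k.+1 - de k * nth1 t k.
Proof.
move=> s_gt0 alq; set y := partial_quot de al X; split=> [yN|[t [X1 XE]]].
  (* The second row of the matrix, applied to (y_k, x_{k+1}), gives t_k; the 0-based [i] stands for
     k = i + 1. *)
  pose t := [tuple q i.+2 * y i.+1 - p i.+1 * X i.+2 | i < s.-1].
  have tE k : (1 <= k < s)%N -> nth1 t k = q k.+1 * y k - p k * X k.+1.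
    case: k => // k lt_ks; have lt_k : (k < s.-1)%N by lia.
    by rewrite /nth1 (nth_mktuple _ _ (Ordinal lt_k)).
  have yS k : (1 <= k < s)%N -> y k.+1 = de k * y k + al k.+1 * X k.+1.
    by case/andP=> k_gt0 _; apply: partial_quotS.
  (* Descending induction from y_s = N: the recursion for [tail_param] inverts the one for [y]. *)
  have yE j : (j < s)%N -> tail_param s p al N t (s - j) = y (s - j)%N.
    elim: j => [|j IHj] lt_js; first by rewrite subn0 tail_param_last.
    have k_int : (1 <= s - j.+1 < s)%N by lia.
    rewrite tail_param_rec //.
    rewrite tE // (_ : (s - j.+1).+1 = s - j)%N; last by lia.
    rewrite IHj; last by lia.
    have := yS _ k_int; have := alq _ k_int.
    rewrite (_ : (s - j.+1).+1 = s - j)%N; last by lia.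
    move=> alqk ->; rewrite mulrBr mulrA alqk; ring.
  have yE' k : (1 <= k <= s)%N -> tail_param s p al N t k = y k.
    by move=> k_int; rewrite -(subKn (n := s) (m := k)) ?yE //; lia.
  exists t; split=> [|k k_int]; first by rewrite yE' // s_gt0.
  rewrite yE' ?yS ?tE //; last by lia.
  rewrite mulrDr [q _ * (al _ * _)]mulrA [q _ * al _]mulrC alq //; ring.
(* Conversely, ascending from x_1, the given formulas make [y] agree with [tail_param], whose last
   value is N. *)
have yE k : (k < s)%N -> y k.+1 = tail_param s p al N t k.+1.
  elim: k => [|k IHk] lt_ks //; have k_int : (1 <= k.+1 < s)%N by [].
  rewrite /y partial_quotS // -/y IHk; last exact: ltnW.
  rewrite tail_param_rec // XE // mulrBr mulrA alq //; ring.
by rewrite -(prednK s_gt0) yE prednK // tail_param_last.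
Qed.

(** Absolute values matter at [i = 1], where [dgcd a 1] is a_1 itself and may be negative. *)
Lemma absz_dgcd (a : seq int) (i : nat) :
  `|dgcd a i|%N = \big[gcdn/0%N]_(0 <= j < i) `|(a`_j)%R|%N.
Proof.
elim: i => [|[|i] IHi]; first by rewrite big_geq.
  by rewrite big_nat1.
by rewrite big_nat_recr //= -IHi.
Qed.

Lemma gcd_all_dgcd (a : seq int) : (2 <= size a)%N ->
  gcd_all a = dgcd a (size a).
Proof.
move=> size_a; have gcd_ge0 : 0 <= gcd_all a.
  by rewrite /gcd_all; elim/big_rec: _.
have dgcd_ge0 : 0 <= dgcd a (size a) by case: (size a) size_a => [|[|]].
rewrite -(gez0_abs gcd_ge0) -(gez0_abs dgcd_ge0) absz_dgcd; congr Posz.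
rewrite /gcd_all (big_morph absz (id1 := 0%N) (op1 := gcdn)) //.
by rewrite (big_nth 0).
Qed.

Lemma dgcd_neq0 (a : seq int) (i : nat) :
  (1 <= i)%N -> nth1 a 1 != 0 -> dgcd a i != 0.
Proof.
move=> + a1; elim: i => // -[|i] IHi _ //=.
by rewrite gcdz_eq0 negb_and IHi.
Qed.

Lemma dgcdE (a : seq int) (i : nat) :
  (1 <= i)%N -> dgcd a i = dgcd a i.+1 * dbar a i.
Proof. by case: i => [|[|i]] // _; [apply: abarE1 | apply: dbarE]. Qed.

(** Both entries are the quotients of d_i and a_{i+1} by their gcd d_{i+1}, which is nonzero and can
    be cancelled. *)
Lemma coprime_dbar_abar (a : seq int) (i : nat) :
  (1 <= i)%N -> nth1 a 1 != 0 -> coprimez (dbar a i) (abar a i.+1).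
Proof.
move=> i_gt0 a1; have d_neq0 := dgcd_neq0 (ltn0Sn i) a1.
have gcdE : dgcd a i.+1 = gcdz (dgcd a i) (nth1 a i.+1) by case: i i_gt0 {d_neq0}.
have d_ge0 : 0 <= dgcd a i.+1 by rewrite gcdE.
apply/eqP/(mulfI d_neq0); rewrite mulr1 -{1}(gez0_abs d_ge0).
by rewrite mulz_gcdr -dgcdE // -abarE // -gcdE.
Qed.

Theorem theorem1p1 (s : nat) (a : s.-tuple int) (n : int)
    (hs : (2 <= s)%N)
    (ha : forall i : nat, (1 <= i <= s)%N -> nth1 a i != 0)
    (hn : (gcd_all a %| n)%Z)
    (x : s.-tuple rat) :
  let n1 : int := (n %/ gcd_all a)%Z in
  let phi (i : nat) : nat := totient `|abar a i|%N in
  let P (j k : nat) : int :=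
    bprod j k (fun i => dbar a i ^+ (phi i.+1 - 1)%N) in
  ((forall i : nat, (1 <= i <= s)%N -> nth1 x i \is a Num.int) /\
   \sum_(1 <= i < s.+1) (nth1 a i)%:~R * nth1 x i = n%:~R)
  <->
  exists t : s.-1.-tuple int,
    nth1 x 1 =
      n1%:~R * (P 1%N (s - 1)%N)%:~R
      + \sum_(1 <= m < s)
          (abar a m.+1)%:~R * (P 1%N (m - 1)%N)%:~R * (nth1 t m)%:~R /\
    forall k : nat, (2 <= k <= s)%N ->
      nth1 x k =
        n1%:~R / (abar a k)%:~R
          * (1 - (dbar a (k - 1)%N)%:~R ^+ phi k) * (P k (s - 1)%N)%:~R
        - (dbar a (k - 1)%N)%:~R * (nth1 t (k - 1)%N)%:~R
        + \sum_(2 <= m < s)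
            (abar a m.+1)%:~R / (abar a k)%:~R
              * (1 - (dbar a (k - 1)%N)%:~R ^+ phi k)
              * (P k (m - 1)%N)%:~R * (nth1 t m)%:~R.
Proof.
move=> n1 phi P.
have s_gt0 : (1 <= s)%N by apply: ltnW.
have a1_neq0 : nth1 a 1 != 0 by apply: ha; rewrite s_gt0.
have gcd_a : gcd_all a = dgcd a s by rewrite gcd_all_dgcd size_tuple.
have d_neq0 : dgcd a s != 0 by apply: dgcd_neq0.
have nE : n = dgcd a s * n1 by rewrite mulrC -gcd_a divzK.
have al_neq0 k : (2 <= k <= s)%N -> abar a k != 0.
  case/andP=> k_ge2 le_ks; have := ha k; rewrite abarE // mulf_eq0 negb_or.
  by rewrite le_ks (ltnW k_ge2) => /(_ isT)/andP[].
pose p i := dbar a i ^+ (phi i.+1 - 1).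
pose q k := ((1 - dbar a k.-1 ^+ phi k) %/ abar a k)%Z.
pose Y (t : seq int) := tail_param s p (abar a) n1 t.
have alq k : (2 <= k <= s)%N -> abar a k * q k = 1 - dbar a k.-1 ^+ phi k.
  case: k => [|k] // k_int; rewrite mulrC divzK //.
  by rewrite dvdz_euler ?al_neq0 // coprime_dbar_abar //; lia.
(* Since the totient of a positive number is positive, the truncated exponent phi - 1 in [p] is
   exact. *)
have alpq k : (1 <= k < s)%N -> abar a k.+1 * q k.+1 = 1 - dbar a k * p k.
  move=> k_int; rewrite alq // -exprS subn1 prednK // totient_gt0 absz_gt0.
  exact: al_neq0.
have formulaE (t : s.-1.-tuple int) k : (2 <= k <= s)%N ->
    n1%:~R / (abar a k)%:~R
      * (1 - (dbar a (k - 1)%N)%:~R ^+ phi k) * (P k (s - 1)%N)%:~R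
    - (dbar a (k - 1)%N)%:~R * (nth1 t (k - 1)%N)%:~R
    + \sum_(2 <= m < s)
        (abar a m.+1)%:~R / (abar a k)%:~R
          * (1 - (dbar a (k - 1)%N)%:~R ^+ phi k)
          * (P k (m - 1)%N)%:~R * (nth1 t m)%:~R
    = (q k * Y t k - dbar a k.-1 * nth1 t k.-1)%:~R :> rat.
  move=> k_int; have [k_ge2 _] := andP k_int; rewrite !subn1.
  have alR : (abar a k)%:~R != 0 :> rat by rewrite intr_eq0 al_neq0.
  have qE : 1 - (dbar a k.-1)%:~R ^+ phi k = (abar a k)%:~R * (q k)%:~R :> rat.
    by rewrite -intrM alq // intrB rmorphXn.
  rewrite qE rmorphB /= !intrM /Y /tail_param subn1 addrAC; congr (_ - _).
  rewrite intrD mulrDr intrM; congr (_ + _); first by field.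
  (* The sum in [tail_param] starts at 1, the stated one at 2; the term [m = 1] vanishes by the
     product convention, as [k] is at least 2. *)
  rewrite [in RHS]big_ltn // bprod_eq0 // mulr0 mul0r add0r rmorph_sum mulr_sumr /=.
  by apply: eq_bigr => m _; rewrite !intrM; field.
have formula1E (t : s.-1.-tuple int) :
    n1%:~R * (P 1%N (s - 1)%N)%:~R
      + \sum_(1 <= m < s)
          (abar a m.+1)%:~R * (P 1%N (m - 1)%N)%:~R * (nth1 t m)%:~R
    = (Y t 1%N)%:~R :> rat.
  rewrite intrD intrM rmorph_sum /=; congr (_ + _).
  by apply: eq_bigr => m _; rewrite !intrM.
(* For integral coordinates the equation reads d_s y_s = d_s n_1, and d_s cancels. *)
have int_solutions X : (forall i, (1 <= i <= s)%N -> nth1 x i = (X i)%:~R) ->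
    \sum_(1 <= i < s.+1) (nth1 a i)%:~R * nth1 x i = n%:~R <->
    exists t : s.-1.-tuple int, X 1%N = Y t 1%N /\
    forall k, (1 <= k < s)%N ->
      X k.+1 = q k.+1 * Y t k.+1 - dbar a k * nth1 t k.
  move=> xX; rewrite -partial_quot_param //.
  rewrite (eq_big_nat _ _ (F2 := fun i => (nth1 a i * X i)%:~R)); last first.
    by move=> i i_int; rewrite intrM xX.
  rewrite -rmorph_sum /= (@partial_quot_sum (dbar a) (abar a) X (dgcd a)) //.
  - by rewrite nE; split=> [/intr_inj/(mulfI d_neq0)|->].
  - exact: dgcdE.
  - exact: abarE.
split=> [[x_int x_sol]|[t [x1E xkE]]].
  pose X i := Num.floor (nth1 x i).
  have xX i : (1 <= i <= s)%N -> nth1 x i = (X i)%:~R.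
    by move=> i_int; rewrite /X floorK // x_int.
  have [t [X1 XS]] := (int_solutions X xX).1 x_sol.
  exists t; rewrite formula1E xX ?s_gt0 // X1; split=> // k k_int.
  rewrite formulaE // xX; last by lia.
  by case: k k_int => [|[|k]] // k_int; rewrite XS.
(* The integer forms of the formulas serve as [X], so integrality of [x] is immediate. *)
pose X k := if (k <= 1)%N then Y t 1%N
            else q k * Y t k - dbar a k.-1 * nth1 t k.-1.
have xX i : (1 <= i <= s)%N -> nth1 x i = (X i)%:~R.
  case: i => [|[|i]] // i_int; first by rewrite x1E formula1E.
  by rewrite xkE // formulaE.
split=> [i i_int|]; first by rewrite xX.
by apply/(int_solutions X xX); exists t; split=> // -[|k].
Qed.
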